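(* Let $\mathcal{T}$ be a Lawvere theory, $\mathcal{V}$ a variety whose Lawvere theory $\mathcal{T}_{\mathcal{V}}$ is commutative, and $\Phi\colon\mathcal{T}\to\mathcal{T}_{\mathcal{V}}$ a morphism of Lawvere theories. Then the following hold. 1. For every $\mathcal{T}$-coalgebra $\mathsf{A}$ in $\mathcal{V}$ the set $G_\Phi(\mathsf{A})$ is the underlying set of a $\mathcal{V}$-subalgebra of $\|\mathsf{A}\|$, such that the functor $G_\Phi$ factors as $\mathsf{Coalg}(\mathcal{T},\mathcal{V})\xrightarrow{\bar G_\Phi}\mathcal{V}\xrightarrow{|-|}\mathrm{Set}$ and the natural transformation $e$ lifts to a natural transformation $\bar e\colon\bar G_\Phi\Rightarrow\|-\|$. The lifted functor $\bar G_\Phi$ satisfies the equations $\bar G_\Phi N_\Phi=\mathrm{id}_{\mathcal{V}}$ and $\bar G_\Phi V_\Phi(X)=F_{\mathcal{V}}X$ for each set $X$. 2. $N_\Phi$ is left adjoint to $\bar G_\Phi$; hence $\mathcal{V}$ is (equivalent to) a full coreflective subcategory of $\mathsf{Coalg}(\mathcal{T},\mathcal{V})$.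
   Context: A Lawvere theory is a category $\mathcal{T}$ with finite products and with a countable set of objects $T_0,T_1,T_2,\dots$ (written $0,1,2,\dots$) such that each $T_n$ is a specified $n$-fold power of $T_1$; morphisms are functors preserving finite products (and the specified powers). $\mathcal{T}$ is commutative if $\sigma\circ\tau^n=\tau\circ\sigma^m\colon n\times m\to1$ for all $\sigma\in\mathcal{T}(n,1)$, $\tau\in\mathcal{T}(m,1)$. $\mathsf{Alg}\,\mathcal{T}$ is the category of finite product preserving functors $\mathcal{T}\to\mathrm{Set}$, with forgetful functor $|-|$ evaluation at $T_1$. A variety $\mathcal{V}$ is concretely equivalent to $\mathsf{Alg}\,\mathcal{T}_{\mathcal{V}}$, where $\mathcal{T}_{\mathcal{V}}$ is the dual of the full subcategory of $\mathcal{V}$ spanned by the free algebras $F_{\mathcal{V}}n$, $n\in\mathbb{N}$; $F_{\mathcal{V}}\colon\mathrm{Set}\to\mathcal{V}$ is the free algebra functor. $\mathsf{Coalg}(\mathcal{T},\mathcal{V})$ is the category of finite coproduct preserving functors $\mathsf{A}\colon\mathcal{T}^{\mathrm{op}}\to\mathcal{V}$ and natural transformations, with forgetful functor $\|-\|$ to $\mathcal{V}$ given by evaluation at $T_1$. Coalgebras $\mathsf{A}$ correspond to functors $R_{\mathsf{A}}\colon\mathcal{V}\to\mathsf{Alg}\,\mathcal{T}$ with $|-|\circ R_{\mathsf{A}}=\mathcal{V}(\|\mathsf{A}\|,-)$, where $R_{\mathsf{A}}(C)=\mathcal{V}(\mathsf{A}(-),C)$. $V_\Phi(1)$ is the $\mathcal{T}$-coalgebra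 $\mathcal{T}^{\mathrm{op}}\xrightarrow{\Phi^{\mathrm{op}}}\mathcal{T}_{\mathcal{V}}^{\mathrm{op}}\hookrightarrow\mathcal{V}$ with underlying algebra $F_{\mathcal{V}}1$, and $V_\Phi(X)=X\cdot V_\Phi(1)$ is its $X$-fold copower in $\mathsf{Coalg}(\mathcal{T},\mathcal{V})$. $G_\Phi:=\hom(V_\Phi(1),-)\colon\mathsf{Coalg}(\mathcal{T},\mathcal{V})\to\mathrm{Set}$. The natural transformation $e\colon G_\Phi\Rightarrow|-|\circ\|-\|$ has as components the injective maps $e_{\mathsf{A}}$ sending a coalgebra morphism $f\colon V_\Phi(1)\to\mathsf{A}$ to the value of its underlying homomorphism $F_{\mathcal{V}}1\to\|\mathsf{A}\|$ at the free generator; via $e_{\mathsf{A}}$, $G_\Phi(\mathsf{A})$ is regarded as a subset of the underlying set of $\|\mathsf{A}\|$. Since $\mathcal{T}_{\mathcal{V}}$ is commutative, each hom-set $\mathcal{V}(A,B)$ is a subalgebra $[A,B]$ of the power $B^{|A|}$. $N\colon\mathcal{V}\to\mathsf{Coalg}(\mathcal{T}_{\mathcal{V}},\mathcal{V})$ is the functor sending $A$ to the $\mathcal{T}_{\mathcal{V}}$-coalgebra with underlying algebra $A$ whose corresponding functor $R_{NA}$ is $[A,-]\colon\mathcal{V}\to\mathcal{V}$. $N_\Phi\colon\mathcal{V}\to\mathsf{Coalg}(\mathcal{T},\mathcal{V})$ is $N$ followed by the functor $\mathsf{Coalg}(\mathcal{T}_{\mathcal{V}},\mathcal{V})\to\mathsf{Coalg}(\mathcal{T},\mathcal{V})$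 given by precomposition with $\Phi^{\mathrm{op}}$. Equalities of functors are understood up to natural isomorphism. *)

(* Defs.v *)
From mathcomp Require Import all_boot.
From mathcomp Require Import boolp classical_sets.

Set Implicit Arguments.
Unset Strict Implicit.
Unset Printing Implicit Defensive.
#[local] Obligation Tactic := idtac.

Record category_on (ob : Type) := CategoryOn {
  hom : ob -> ob -> Type;
  idm : forall a, hom a a;
  cmp : forall a b c, hom b c -> hom a b -> hom a c;
  cmp1m : forall a b (f : hom a b), cmp (idm b) f = f;
  cmpm1 : forall a b (f : hom a b), cmp f (idm a) = f;
  cmpA : forall a b c d (h : hom c d) (g : hom b c) (f : hom a b),
    cmp h (cmp g f) = cmp (cmp h g) f
}.
Arguments idm {ob _} a.

Record category := Category { ob :> Type; cat_str :> category_on ob }.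

Notation "g \oc f" := (cmp g f) (at level 40, left associativity).

Definition op (C : category) : category :=
  Category {| hom a b := hom C b a; idm a := idm a;
    cmp _ _ _ g f := f \oc g;
    cmp1m _ _ f := cmpm1 f; cmpm1 _ _ f := cmp1m f;
    cmpA _ _ _ _ h g f := esym (cmpA f g h) |}.

Definition SET : category :=
  Category {| hom (X Y : Type) := X -> Y; idm X := fun x => x;
    cmp _ _ _ g f := fun x => g (f x);
    cmp1m _ _ _ := erefl; cmpm1 _ _ _ := erefl;
    cmpA _ _ _ _ _ _ _ := erefl |}.

Definition is_iso (C : category) (a b : C) (f : hom C a b) : Prop :=
  exists g : hom C b a, g \oc f = idm a /\ f \oc g = idm b.

Record functor (C D : category) := Functor {
  fob :> C -> D;
  fmap : forall a b, hom C a b -> hom D (fob a) (fob b);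
  fmap1 : forall a, fmap (idm a) = idm (fob a);
  fmapM : forall a b c (g : hom C b c) (f : hom C a b),
    fmap (g \oc f) = fmap g \oc fmap f
}.
Arguments fmap {C D} _ {a b} _.

Definition functor_id (C : category) : functor C C :=
  {| fob a := a; fmap _ _ f := f;
     fmap1 _ := erefl; fmapM _ _ _ _ _ := erefl |}.

Program Definition functor_comp (C D E : category) (G : functor D E)
    (F : functor C D) : functor C E :=
  {| fob a := G (F a); fmap _ _ f := fmap G (fmap F f) |}.
Next Obligation. by move=> C D E G F a /=; rewrite !fmap1. Qed.
Next Obligation. by move=> C D E G F a b c g f /=; rewrite !fmapM. Qed.

Definition functor_op (C D : category) (F : functor C D) :
    functor (op C) (op D) :=
  @Functor (op C) (op D) F (fun a b f => @fmap C D F b a f)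
    (fun a => @fmap1 C D F a) (fun a b c g f => @fmapM C D F c b a f g).

Definition hom_functor (C : category) (a : C) : functor C SET :=
  @Functor C SET (fun b => hom C a b) (fun b c g f => g \oc f)
    (fun b => funext (fun f => cmp1m f))
    (fun b c d h g => funext (fun f => esym (cmpA h g f))).

Record nat_trans (C D : category) (F G : functor C D) := NatTrans {
  component :> forall a, hom D (F a) (G a);
  naturality : forall a b (f : hom C a b),
    component b \oc fmap F f = fmap G f \oc component a
}.

Definition nat_isomorphic (C D : category) (F G : functor C D) : Prop :=
  exists s : nat_trans F G, forall a, is_iso (s a).

Definition full_sub (C : category) (P : C -> Prop) : category :=
  Category {| hom (a b : {a : C | P a}) := hom C (sval a) (sval b);
    idm a := idm (sval a); cmp _ _ _ g f := g \oc f;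
    cmp1m _ _ f := cmp1m f; cmpm1 _ _ f := cmpm1 f;
    cmpA _ _ _ _ h g f := cmpA h g f |}.

Definition full_incl (C : category) (P : C -> Prop) : functor (full_sub P) C :=
  @Functor (full_sub P) C (fun a => sval a) (fun _ _ f => f)
    (fun _ => erefl) (fun _ _ _ _ _ => erefl).

Definition left_adjoint (C D : category) (L : functor C D) (R : functor D C) : Prop :=
  exists (unit : nat_trans (functor_id C) (functor_comp R L))
         (counit : nat_trans (functor_comp L R) (functor_id D)),
    (forall a, counit (L a) \oc fmap L (unit a) = idm (L a)) /\
    (forall b, fmap R (counit b) \oc unit (R b) = idm (R b)).

Definition is_equivalence (C D : category) (E : functor C D) : Prop :=
  exists E' : functor D C,
    nat_isomorphic (functor_comp E' E) (functor_id C) /\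
    nat_isomorphic (functor_comp E E') (functor_id D).

Definition coreflective (C : category) (P : C -> Prop) : Prop :=
  exists R : functor C (full_sub P), left_adjoint (full_incl P) R.

Definition is_product (C : category) (I : Type) (X : I -> C) (P : C)
    (p : forall i, hom C P (X i)) : Prop :=
  forall (Q : C) (q : forall i, hom C Q (X i)),
    exists! h : hom C Q P, forall i, p i \oc h = q i.

Definition is_coproduct (C : category) (I : Type) (X : I -> C) (P : C)
    (p : forall i, hom C (X i) P) : Prop :=
  forall (Q : C) (q : forall i, hom C (X i) Q),
    exists! h : hom C P Q, forall i, h \oc p i = q i.

Definition preserves_finite_products (C D : category) (F : functor C D) : Prop :=
  forall n (X : 'I_n -> C) (P : C) (p : forall i, hom C P (X i)),
    is_product p -> is_product (fun i => fmap F (p i)).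

Definition preserves_finite_coproducts (C D : category) (F : functor C D) : Prop :=
  forall n (X : 'I_n -> C) (P : C) (p : forall i, hom C (X i) P),
    is_coproduct p -> is_coproduct (fun i => fmap F (p i)).

Section Coproducts.
Variables (C : category) (I : Type) (X : I -> C) (P : C).
Variable p : forall i, hom C (X i) P.
Hypothesis Pp : is_coproduct p.

Definition desc (Q : C) (q : forall i, hom C (X i) Q) : hom C P Q :=
  sval (cid (Pp q)).

Lemma descE Q (q : forall i, hom C (X i) Q) i : desc q \oc p i = q i.
Proof. by rewrite /desc; case: cid => h [hq _] /=; apply: hq. Qed.

Lemma coproduct_ext Q (h h' : hom C P Q) :
  (forall i, h \oc p i = h' \oc p i) -> h = h'.
Proof.
move=> hh'; have [k [_ ku]] := Pp (fun i => h \oc p i).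
by rewrite -(ku h) // -(ku h').
Qed.
End Coproducts.

Lemma is_coproductI (C : category) (I : Type) (X : I -> C) (P : C)
    (p : forall i, hom C (X i) P) :
  (forall Q (q : forall i, hom C (X i) Q), exists h : hom C P Q, forall i, h \oc p i = q i) ->
  (forall Q (h h' : hom C P Q), (forall i, h \oc p i = h' \oc p i) -> h = h') ->
  is_coproduct p.
Proof.
move=> ex un Q q; have [h hq] := ex Q q; exists h; split=> // h' h'q.
by apply: un => i; rewrite hq h'q.
Qed.

Record copower (C : category) (I : Type) (a : C) := Copower {
  cp_ob : C;
  cp_in : I -> hom C a cp_ob;
  cp_univ : is_coproduct (fun i : I => cp_in i)
}.
Arguments cp_in {C I a} _ _.

Definition cp_desc (C : category) (I : Type) (a : C) (c : copower I a) (b : C)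
  (f : I -> hom C a b) : hom C (cp_ob c) b := desc (@cp_univ _ _ _ c) f.

Lemma cp_descE (C : category) (I : Type) (a : C) (c : copower I a) (b : C)
  (f : I -> hom C a b) i : cp_desc c f \oc cp_in c i = f i.
Proof. exact: (descE (@cp_univ _ _ _ c)). Qed.

Lemma cp_ext (C : category) (I : Type) (a : C) (c : copower I a) (b : C)
    (h h' : hom C (cp_ob c) b) :
  (forall i, h \oc cp_in c i = h' \oc cp_in c i) -> h = h'.
Proof. exact: (coproduct_ext (@cp_univ _ _ _ c)). Qed.

Program Definition copower_functor (C : category) (a : C)
    (c : forall I, copower I a) : functor SET C :=
  @Functor SET C (fun I => cp_ob (c I))
    (fun I J f => cp_desc (c I) (fun i => cp_in (c J) (f i))) _ _.
Next Obligation. by move=> C a c I /=; apply: cp_ext => i; rewrite cp_descE cmp1m. Qed.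
Next Obligation.
by move=> C a c I J K g f /=; apply: cp_ext => i; rewrite -cmpA !cp_descE.
Qed.

(* The objects T_0, T_1, ... are indexed by nat. Products of arbitrary finite
   families exist because T_(n_1 + ... + n_k) is a product of the T_(n_i), see
   lawvere_finite_products. *)
Record lawvere := Lawvere {
  lw_on : category_on nat;
  proj : forall n, 'I_n -> hom lw_on n 1;
  proj_power : forall n,
    @is_product (Category lw_on) 'I_n (fun=> 1) n (fun i => proj i)
}.
Coercion lw_category (T : lawvere) : category := Category (lw_on T).
Arguments proj _ {n} _.

Section Tuplings.
Variable T : lawvere.

Definition tupling (k n : nat) (f : 'I_n -> hom T k 1) : hom T k n :=
  sval (cid (@proj_power T n k f)).

Lemma tuplingE k n (f : 'I_n -> hom T k 1) i : @cmp _ T _ _ _ (proj T i) (tupling f) = f i.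
Proof. by rewrite /tupling; case: cid => h [hf _] /=; apply: hf. Qed.

Lemma proj_ext k n (h h' : hom T k n) :
  (forall i, @cmp _ T _ _ _ (proj T i) h = @cmp _ T _ _ _ (proj T i) h') -> h = h'.
Proof. exact: (@coproduct_ext (op T) _ _ _ _ (@proj_power T n)). Qed.

(* T_(n x m) is the power of T_1 indexed by the pairs in 'I_n * 'I_m, as
   numbered by enum_rank.  The two inner tuples below are
   tau^n : (T_m)^n -> T_1^n and sigma^m : (T_n)^m -> T_1^m. *)
Definition commutative_theory : Prop :=
  forall (n m : nat) (sigma : hom T n 1) (tau : hom T m 1),
  let x (i : 'I_n) (j : 'I_m) : hom T #|{: 'I_n * 'I_m}| 1 :=
    proj T (enum_rank (i, j)) in
  let tau_n := tupling (fun i => tau \oc tupling (fun j => x i j)) in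
  let sigma_m := tupling (fun j => sigma \oc tupling (fun i => x i j)) in
  sigma \oc tau_n = tau \oc sigma_m.
End Tuplings.

Section FiniteProducts.
Variables (T : lawvere) (k : nat) (X : 'I_k -> nat).
Let S : finType := {i : 'I_k & 'I_(X i)}.

Definition sum_proj (i : 'I_k) : hom T #|S| (X i) :=
  tupling (fun j => proj T (enum_rank (Tagged (fun i => 'I_(X i)) j))).

Lemma lawvere_finite_products :
  @is_product T _ X #|S| sum_proj.
Proof.
refine (@is_coproductI (op T) _ X #|S| sum_proj _ _) => /= Q.
- move=> q; exists (tupling (fun r => @cmp _ T _ _ _ (proj T (tagged (enum_val r))) (q (tag (enum_val r))))).
  by move=> i; apply: proj_ext => j; rewrite cmpA !tuplingE enum_rankK.
- move=> h h' hh'; apply: proj_ext => r.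
  rewrite -[r]enum_valK; case: (enum_val r) => i j.
  by move: (congr1 (cmp (proj T j)) (hh' i)); rewrite !cmpA !tuplingE.
Qed.
End FiniteProducts.

Lemma preserves_powers_coproducts (T : lawvere) (D : category)
    (A : functor (op T) D) :
  (forall n, is_coproduct (fun i : 'I_n => @fmap _ _ A 1 n (proj T i))) ->
  preserves_finite_coproducts A.
Proof.
move=> HA k X P p Pp; pose p' : forall i, hom T P (X i) := p.
have AM (a b c : T) (g : hom T b c) (f : hom T a b) :
  @fmap _ _ A c a (g \oc f) = @fmap _ _ A b a f \oc @fmap _ _ A c b g.
  exact: (@fmapM (op T) D A c b a f g).
pose q := @sum_proj T k X; set N := #|_| in q.
have [u [uq _]] : exists! u : hom T N P, forall i, p' i \oc u = q i := Pp N q.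
have [v [vp _]] : exists! v : hom T P N, forall i, q i \oc v = p' i :=
  lawvere_finite_products p'.
have uv : u \oc v = idm P.
  apply: (@coproduct_ext (op T) _ _ _ _ Pp) => i /=.
  by rewrite cmpA uq vp cmpm1.
apply: is_coproductI => Q.
- move=> g.
  pose w := desc (@HA N) (fun r => g (tag (enum_val r)) \oc
    @fmap _ _ A 1 _ (proj T (tagged (enum_val r)))).
  exists (w \oc @fmap _ _ A P N u) => i.
  rewrite -cmpA -AM uq.
  apply: (coproduct_ext (@HA (X i))) => j.
  rewrite -cmpA -AM /q tuplingE.
  by rewrite (descE (@HA N)) enum_rankK.
- move=> h h' hh'.
  have hE (l : hom D (A P) Q) : l = (l \oc @fmap _ _ A N P v) \oc @fmap _ _ A P N u.
    by rewrite -cmpA -AM uv (@fmap1 (op T) D A) cmpm1.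
  rewrite (hE h) (hE h'); congr (_ \oc _).
  apply: (coproduct_ext (@HA N)) => r.
  rewrite -[r]enum_valK; case: (enum_val r) => i j.
  rewrite -!cmpA -!AM.
  have -> : proj T (enum_rank (existT (fun i => 'I_(X i)) i j)) = @cmp _ T _ _ _ (proj T j) (q i).
    by rewrite tuplingE.
  by rewrite -cmpA vp AM !cmpA hh'.
Qed.

(* Preservation of all finite products is automatic, see theory_morphism_products. *)
Record theory_morphism (T S : lawvere) := TheoryMorphism {
  tm_map : forall n m, hom T n m -> hom S n m;
  tm_id : forall n, tm_map (idm n) = idm n;
  tm_comp : forall n m k (g : hom T m k) (f : hom T n m),
    tm_map (g \oc f) = tm_map g \oc tm_map f;
  tm_proj : forall n (i : 'I_n), tm_map (proj T i) = proj S i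
}.

Definition theory_functor (T S : lawvere) (Phi : theory_morphism T S) : functor T S :=
  @Functor T S (fun n => n) (@tm_map _ _ Phi) (@tm_id _ _ Phi) (@tm_comp _ _ Phi).

Lemma theory_morphism_op_coproducts (T S : lawvere) (Phi : theory_morphism T S) :
  preserves_finite_coproducts (functor_op (theory_functor Phi)).
Proof.
apply: preserves_powers_coproducts => n /=.
have -> : (fun i : 'I_n => tm_map Phi (proj T i)) = (fun i => proj S i).
  by apply: functional_extensionality_dep => i; rewrite tm_proj.
exact: (@proj_power S n).
Qed.

Lemma theory_morphism_products (T S : lawvere) (Phi : theory_morphism T S) :
  preserves_finite_products (theory_functor Phi).
Proof. exact: (@theory_morphism_op_coproducts T S Phi). Qed.

Record signature := Signature { symbol : Type; arity : symbol -> nat }.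

Inductive term (S : signature) (X : Type) : Type :=
| Var of X
| App (o : symbol S) of ('I_(arity o) -> term S X).
Arguments Var {S X} _.
Arguments App {S X} _ _.

Fixpoint eval (S : signature) (X A : Type)
    (oper : forall o : symbol S, ('I_(arity o) -> A) -> A)
    (v : X -> A) (t : term S X) : A :=
  match t with
  | Var x => v x
  | App o ts => oper o (fun i => eval oper v (ts i))
  end.

(* A variety, presented by a signature and a set of equations in the variables
   indexed by nat (every term uses only finitely many of them). *)
Record variety := Variety {
  sig : signature;
  equation : term sig nat -> term sig nat -> Prop
}.

Record algebra (V : variety) := Algebra {
  carrier :> Type;
  oper : forall o : symbol (sig V), ('I_(arity o) -> carrier) -> carrier;
  oper_equation : forall s t, equation s t ->
    forall v : nat -> carrier, eval oper v s = eval oper v t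
}.

Record alg_hom (V : variety) (A B : algebra V) := AlgHom {
  fun_of_hom :> A -> B;
  hom_oper : forall (o : symbol (sig V)) (x : 'I_(arity o) -> A),
    fun_of_hom (oper x) = oper (fun i => fun_of_hom (x i))
}.

Definition subalgebra (V : variety) (A : algebra V) (S : set A) : Prop :=
  forall (o : symbol (sig V)) (x : 'I_(arity o) -> A),
    (forall i, S (x i)) -> S (oper x).

Section AlgebraCategory.
Variable V : variety.

Lemma alg_hom_ext (A B : algebra V) (f g : alg_hom A B) : (forall x, f x = g x) -> f = g.
Proof.
case: f g => [f fh] [g gh] /= fg; have {}fg : f = g by apply: funext.
by subst g; congr AlgHom; apply: Prop_irrelevance.
Qed.

Definition alg_id (A : algebra V) : alg_hom A A :=
  @AlgHom V A A (fun x => x) (fun _ _ => erefl).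

Program Definition alg_comp (A B C : algebra V) (g : alg_hom B C) (f : alg_hom A B) :
  alg_hom A C := {| fun_of_hom x := g (f x) |}.
Next Obligation. by move=> A B C g f o x /=; rewrite !hom_oper. Qed.

Program Definition alg_category : category :=
  Category {| hom (A B : algebra V) := alg_hom A B; idm := alg_id; cmp := alg_comp |}.
Next Obligation. by move=> A B f; apply: alg_hom_ext. Qed.
Next Obligation. by move=> A B f; apply: alg_hom_ext. Qed.
Next Obligation. by move=> A B C D h g f; apply: alg_hom_ext. Qed.
End AlgebraCategory.
Coercion alg_category : variety >-> category.

Definition forget (V : variety) : functor V SET :=
  @Functor V SET (fun A : algebra V => carrier A) (fun A B (f : alg_hom A B) => (f : A -> B))
    (fun _ => erefl) (fun _ _ _ _ _ => erefl).

Local Notation ev v t := (eval (@oper _ _) v t).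

Lemma hom_eval (V : variety) (A B : algebra V) (f : alg_hom A B) X (v : X -> A)
  (t : term (sig V) X) : f (ev v t) = ev (fun x => f (v x)) t.
Proof.
elim: t => //= o ts IH; rewrite hom_oper; congr oper.
by apply: funext => i; rewrite IH.
Qed.

Fixpoint tsubst (S : signature) X Y (v : X -> term S Y) (t : term S X) : term S Y :=
  match t with
  | Var x => v x
  | App o ts => App o (fun i => tsubst v (ts i))
  end.

Lemma eval_tsubst (S : signature) X Y (A : Type)
    (oper : forall o : symbol S, ('I_(arity o) -> A) -> A)
    (v : X -> term S Y) (w : Y -> A) (t : term S X) :
  eval oper w (tsubst v t) = eval oper (fun x => eval oper w (v x)) t.
Proof. by elim: t => //= o ts IH; congr oper; apply: funext => i; rewrite IH. Qed.

Section Presented.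
Variables (V : variety) (X : Type) (R : term (sig V) X -> term (sig V) X -> Prop).

Definition valid (A : algebra V) (v : X -> A) : Prop :=
  forall s t, R s t -> ev v s = ev v t.

(* s and t denote the same element of the presented algebra iff the relations
   R force their values to agree in all algebras of V. *)
Definition entails (s t : term (sig V) X) : Prop :=
  forall (A : algebra V) (v : X -> A), valid v -> ev v s = ev v t.

Definition pres_carrier := {c : term (sig V) X -> Prop | exists t, c = entails t}.

Definition cls (t : term (sig V) X) : pres_carrier :=
  exist _ (entails t) (ex_intro _ t erefl).

Definition repr (c : pres_carrier) : term (sig V) X := sval (cid (svalP c)).

Lemma reprK c : cls (repr c) = c.
Proof.
rewrite /repr; case: cid => t /= ct; case: c ct => c ec /= ct.
by rewrite /cls; subst c; congr exist; apply: Prop_irrelevance.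
Qed.

Lemma cls_eq s t : entails s t -> cls s = cls t.
Proof.
move=> st; have e : entails s = entails t.
  apply/funext => u; apply/propext; split=> h A v Rv; first by rewrite -st ?h.
  by rewrite st ?h.
by apply: eq_exist.
Qed.

Lemma cls_entails s t : cls s = cls t -> entails s t.
Proof. by case=> /(congr1 (@^~ t)) /= ->. Qed.

Definition pres_oper (o : symbol (sig V)) (x : 'I_(arity o) -> pres_carrier) :
  pres_carrier := cls (App o (fun i => repr (x i))).

Lemma repr_cls t : entails (repr (cls t)) t.
Proof. by apply: cls_entails; rewrite reprK. Qed.

Lemma pres_eval Y (v : Y -> pres_carrier) (t : term (sig V) Y) :
  eval pres_oper v t = cls (tsubst (fun y => repr (v y)) t).
Proof.
elim: t => [y|o ts IH] /=; first by rewrite reprK.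
apply: cls_eq => A w Rw /=; congr oper; apply: funext => i.
by rewrite IH repr_cls.
Qed.

Lemma pres_equation s t : equation s t ->
  forall v : nat -> pres_carrier, eval pres_oper v s = eval pres_oper v t.
Proof.
move=> st v; rewrite !pres_eval; apply: cls_eq => A w Rw.
by rewrite !eval_tsubst; apply: oper_equation.
Qed.

Definition presented : algebra V := Algebra pres_equation.

Definition gen (x : X) : presented := cls (Var x).

Lemma eval_gen t : ev gen t = cls t.
Proof.
rewrite [LHS]pres_eval; apply: cls_eq => A v Rv.
rewrite eval_tsubst; elim: t => [x|o ts IH] /=; first by rewrite repr_cls.
by congr oper; apply: funext.
Qed.

Lemma gen_valid : valid gen.
Proof. by move=> s t st; rewrite !eval_gen; apply: cls_eq => A v; apply. Qed.

Program Definition pres_ext (A : algebra V) (v : X -> A) (Rv : valid v) :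
    hom V presented A := @AlgHom V presented A (fun c => ev v (repr c)) _.
Next Obligation. by move=> A v Rv o x /=; rewrite repr_cls. Qed.

Lemma pres_ext_gen (A : algebra V) (v : X -> A) (Rv : valid v) x :
  pres_ext Rv (gen x) = v x.
Proof. by rewrite /= repr_cls. Qed.

Lemma pres_hom_ext (A : algebra V) (f g : alg_hom presented A) :
  (forall x, f (gen x) = g (gen x)) -> f = g.
Proof.
move=> fg; apply: alg_hom_ext => c; rewrite -(reprK c) -eval_gen !hom_eval.
by congr (eval _ _ _); apply: funext.
Qed.
End Presented.

Definition free (V : variety) (X : Type) : algebra V :=
  @presented V X (fun _ _ => False).

Definition eta (V : variety) (X : Type) (x : X) : free V X := gen _ x.
Arguments eta V {X} x.

Definition free_ext (V : variety) (X : Type) (A : algebra V) (v : X -> A) :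
    hom V (free V X) A := @pres_ext V X (fun _ _ => False) A v (fun _ _ => False_ind _).

Lemma free_extE (V : variety) (X : Type) (A : algebra V) (v : X -> A) x :
  free_ext v (eta V x) = v x.
Proof. exact: pres_ext_gen. Qed.

Lemma free_hom_ext (V : variety) (X : Type) (A : algebra V) (f g : alg_hom (free V X) A) :
  (forall x, f (eta V x) = g (eta V x)) -> f = g.
Proof. exact: pres_hom_ext. Qed.

Lemma free_comp (V : variety) (X : Type) (A B : algebra V) (v : X -> A) (f : alg_hom A B) :
  @cmp _ V _ _ _ f (free_ext v) = free_ext (fun x => f (v x)).
Proof.
apply: free_hom_ext => x.
by rewrite -[LHS]/(f (free_ext v (eta V x))) !free_extE.
Qed.

Program Definition free_functor (V : variety) : functor SET V :=
  @Functor SET V (fun X => free V X) (fun X Y f => free_ext (fun x => eta V (f x))) _ _.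
Next Obligation. by move=> V X /=; apply: free_hom_ext => x; rewrite free_extE. Qed.
Next Obligation.
move=> V X Y Z g f /=; apply: free_hom_ext => x.
by rewrite free_extE -[RHS]/(free_ext _ (free_ext _ _)) !free_extE.
Qed.

Definition free_algebras (V : variety) : category :=
  @Category nat {| hom (n m : nat) := hom V (free V 'I_n) (free V 'I_m);
    idm n := idm (free V 'I_n : V);
    cmp _ _ _ g f := @cmp _ V _ _ _ g f;
    cmp1m _ _ f := @cmp1m _ V _ _ f; cmpm1 _ _ f := @cmpm1 _ V _ _ f;
    cmpA _ _ _ _ h g f := @cmpA _ V _ _ _ _ h g f |}.

Definition gen_proj (V : variety) (n : nat) (i : 'I_n) :
    hom (op (free_algebras V)) n 1 := free_ext (fun _ : 'I_1 => eta V i).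

Lemma gen_proj_power (V : variety) (n : nat) :
  @is_product (op (free_algebras V)) 'I_n (fun=> 1) n (@gen_proj V n).
Proof.
move=> Q q.
have E (h : alg_hom (free V 'I_n) (free V 'I_Q)) i (j : 'I_1) :
    @cmp _ V _ _ _ h (@gen_proj V n i) (eta V j) = h (eta V i).
  by rewrite -[LHS]/(h (gen_proj V i (eta V j))) free_extE.
exists (free_ext (fun i => q i (eta V ord0))); split=> [i|h hq].
- apply: free_hom_ext => j; apply: (eq_trans (E _ i j)).
  by rewrite free_extE (ord1 j).
- apply: free_hom_ext => i; rewrite free_extE -hq; exact: (E h i ord0).
Qed.

Definition theory_of (V : variety) : lawvere :=
  @Lawvere (cat_str (op (free_algebras V))) (@gen_proj V) (@gen_proj_power V).

Definition free_incl (V : variety) : functor (op (theory_of V)) V :=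
  @Functor (op (theory_of V)) V (fun n => free V 'I_n) (fun _ _ f => f)
    (fun _ => erefl) (fun _ _ _ _ _ => erefl).

Lemma free_incl_coproducts (V : variety) : preserves_finite_coproducts (free_incl V).
Proof.
apply: preserves_powers_coproducts => n; apply: is_coproductI => Q.
- move=> q; exists (free_ext (fun i => q i (eta V (ord0 : 'I_1)))) => i.
  apply: free_hom_ext => j.
  rewrite -[LHS]/(free_ext _ (gen_proj V i (eta V j))) !free_extE.
  by rewrite (ord1 j).
- move=> h h' hh'; apply: free_hom_ext => i.
  have := congr1 (fun f : alg_hom (free V 'I_1) Q => f (eta V ord0)) (hh' i).
  have E (k : alg_hom (free V 'I_n) Q) :
    @cmp _ V _ _ _ k (fmap (free_incl V) (proj (theory_of V) i)) (eta V ord0) = k (eta V i).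
    by rewrite -[LHS]/(k (gen_proj V i (eta V ord0))) free_extE.
  by rewrite !E.
Qed.

Section AlgCopower.
Variables (V : variety) (I : Type) (A : algebra V).

(* I . A is generated by I * A, subject to: a |-> (i, a) is a homomorphism. *)
Definition copower_rel (s t : term (sig V) (I * A)) : Prop :=
  exists i (o : symbol (sig V)) (x : 'I_(arity o) -> A),
    s = Var (i, oper x) /\ t = App o (fun k => Var (i, x k)).

Definition alg_copower_ob : algebra V := presented copower_rel.

Program Definition alg_copower_in (i : I) : hom V A alg_copower_ob :=
  @AlgHom V A alg_copower_ob (fun a => gen copower_rel (i, a)) _.
Next Obligation.
move=> i o x.
exact: (@gen_valid V _ copower_rel (Var (i, oper x)) (App o (fun k => Var (i, x k)))
  (ex_intro _ i (ex_intro _ o (ex_intro _ x (conj erefl erefl))))).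
Qed.

Lemma alg_copower_univ : is_coproduct (C := V) alg_copower_in.
Proof.
apply: is_coproductI => Q.
- move=> q.
  have qv : valid copower_rel (fun ia : I * A => q ia.1 ia.2).
    by move=> s t [i [o [x [-> ->]]]] /=; apply: hom_oper.
  exists (pres_ext qv) => i; apply: alg_hom_ext => a.
  exact: (pres_ext_gen qv (i, a)).
- move=> h h' hh'; apply: pres_hom_ext => -[i a].
  exact: (congr1 (fun f : alg_hom A Q => f a) (hh' i)).
Qed.

Definition alg_copower : copower I (A : V) := Copower alg_copower_univ.
End AlgCopower.

Record coalgebra (T : lawvere) (V : variety) := Coalgebra {
  co_functor :> functor (op T) V;
  co_coproducts : preserves_finite_coproducts co_functor
}.

(* Natural transformations.  This repeats nat_trans because the components of
   the latter range over the objects of an arbitrary category, which need not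
   live in the universe of hom-sets. *)
Record coalg_hom (T : lawvere) (V : variety) (A B : coalgebra T V) := CoalgHom {
  co_component :> forall n : nat, hom V (A n) (B n);
  co_naturality : forall (n m : nat) (f : hom (op T) n m),
    co_component m \oc fmap A f = fmap B f \oc co_component n
}.

Lemma coalg_hom_ext (T : lawvere) (V : variety) (A B : coalgebra T V)
  (s t : coalg_hom A B) : (forall n, s n = t n) -> s = t.
Proof.
case: s t => [s sn] [t tn] /= st.
have {}st : s = t by apply: functional_extensionality_dep.
by subst t; congr CoalgHom; apply: Prop_irrelevance.
Qed.

Program Definition coalg_id (T : lawvere) (V : variety) (A : coalgebra T V) :
  coalg_hom A A := {| co_component n := idm (A n) |}.
Next Obligation. by move=> T V A n m f; rewrite cmp1m cmpm1. Qed.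

Program Definition coalg_comp (T : lawvere) (V : variety) (A B C : coalgebra T V)
    (t : coalg_hom B C) (s : coalg_hom A B) : coalg_hom A C :=
  {| co_component n := t n \oc s n |}.
Next Obligation.
by move=> T V A B C t s n m f; rewrite -cmpA co_naturality !cmpA co_naturality.
Qed.

Program Definition Coalg (T : lawvere) (V : variety) : category :=
  Category {| hom (A B : coalgebra T V) := coalg_hom A B;
    idm A := coalg_id A; cmp _ _ _ t s := coalg_comp t s |}.
Next Obligation. by move=> T V A B f; apply: coalg_hom_ext => n; apply: (@cmp1m _ V). Qed.
Next Obligation. by move=> T V A B f; apply: coalg_hom_ext => n; apply: (@cmpm1 _ V). Qed.
Next Obligation. by move=> T V A B C D h g f; apply: coalg_hom_ext => n; apply: (@cmpA _ V). Qed.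

Definition underlying (T : lawvere) (V : variety) : functor (Coalg T V) V :=
  @Functor (Coalg T V) V (fun A : coalgebra T V => A 1%N)
    (fun _ _ (f : coalg_hom _ _) => f 1%N) (fun _ => erefl) (fun _ _ _ _ _ => erefl).

Program Definition coalg_precomp (T S : lawvere) (V : variety)
    (Phi : theory_morphism T S) : functor (Coalg S V) (Coalg T V) :=
  @Functor (Coalg S V) (Coalg T V)
    (fun A : coalgebra S V =>
       @Coalgebra T V (functor_comp A (functor_op (theory_functor Phi))) _)
    (fun (A B : coalgebra S V) (s : coalg_hom A B) =>
       @CoalgHom T V _ _ (fun n => s n) _) _ _.
Next Obligation.
move=> T S V Phi A n X P p Pp.
exact: (@co_coproducts S V A n _ _ _ (theory_morphism_op_coproducts Pp)).
Qed.
Next Obligation. by move=> T S V Phi A B s n m f /=; apply: co_naturality. Qed.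
Next Obligation. by move=> T S V Phi A /=; apply: coalg_hom_ext. Qed.
Next Obligation. by move=> T S V Phi A B C t s /=; apply: coalg_hom_ext. Qed.

Section CoalgCopower.
Variables (T : lawvere) (V : variety) (I : Type) (A : coalgebra T V).

Local Notation cp n := (@alg_copower V I (A n)).

Program Definition coalg_copower_functor : functor (op T) V :=
  @Functor (op T) V (fun n => cp_ob (cp n))
    (fun n m f => cp_desc (cp n) (fun i => @cmp _ V _ _ _ (cp_in (cp m) i) (fmap A f))) _ _.
Next Obligation.
move=> n; apply: (cp_ext (c := cp n)) => i.
by rewrite cp_descE fmap1 cmp1m cmpm1.
Qed.
Next Obligation.
move=> n m k g f; apply: (cp_ext (c := cp n)) => i.
by rewrite cp_descE -cmpA cp_descE cmpA cp_descE -cmpA -fmapM.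
Qed.

Lemma coalg_copower_coproducts : preserves_finite_coproducts coalg_copower_functor.
Proof.
apply: preserves_powers_coproducts => n.
have HA := @co_coproducts T V A n (fun=> 1) n (fun i => proj T i) (@proj_power T n).
apply: is_coproductI => Q.
- move=> q.
  exists (cp_desc (cp n) (fun x => desc HA (fun i => @cmp _ V _ _ _ (q i) (cp_in (cp 1) x)))).
  move=> i; apply: (cp_ext (c := cp 1)) => x.
  by rewrite -cmpA cp_descE cmpA cp_descE (descE HA).
- move=> h h' hh'; apply: (cp_ext (c := cp n)) => x.
  apply: (coproduct_ext HA) => i.
  have := congr1 (fun f => @cmp _ V _ _ _ f (cp_in (cp 1) x)) (hh' i).
  by rewrite -!cmpA !cp_descE.
Qed.

Definition coalg_copower_ob : coalgebra T V := Coalgebra coalg_copower_coproducts.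

Program Definition coalg_copower_in (i : I) : hom (Coalg T V) A coalg_copower_ob :=
  @CoalgHom T V A coalg_copower_ob (fun n => cp_in (cp n) i) _.
Next Obligation. by move=> i n m f; exact: (esym (cp_descE (cp n) _ i)). Qed.

Lemma coalg_copower_univ : is_coproduct (C := Coalg T V) coalg_copower_in.
Proof.
apply: is_coproductI => B.
- move=> q; unshelve eexists.
    refine (@CoalgHom T V coalg_copower_ob B (fun n => cp_desc (cp n) (fun i => (q i : coalg_hom _ _) n)) _).
    move=> n m f; apply: (cp_ext (c := cp n)) => i.
    by rewrite -!cmpA !cp_descE cmpA cp_descE co_naturality.
  by move=> i; apply: coalg_hom_ext => n; exact: (cp_descE (cp n)).
- move=> h h' hh'; apply: coalg_hom_ext => n; apply: (cp_ext (c := cp n)) => i.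
  exact: (congr1 (fun f : coalg_hom A B => f n) (hh' i)).
Qed.

Definition coalg_copower : copower I (A : Coalg T V) := Copower coalg_copower_univ.
End CoalgCopower.

Section VG.
Variables (T : lawvere) (V : variety) (Phi : theory_morphism T (theory_of V)).

Lemma V_Phi_1_coproducts : preserves_finite_coproducts
  (functor_comp (free_incl V) (functor_op (theory_functor Phi))).
Proof.
move=> n X P p Pp.
exact: (@free_incl_coproducts V n _ _ _ (theory_morphism_op_coproducts Pp)).
Qed.

Definition V_Phi_1 : coalgebra T V := Coalgebra V_Phi_1_coproducts.

Definition V_Phi : functor SET (Coalg T V) :=
  copower_functor (fun X => coalg_copower X V_Phi_1).

Definition G_Phi : functor (Coalg T V) SET := @hom_functor (Coalg T V) V_Phi_1.

(* The algebra V_Phi_1 1 is free V 'I_1, with free generator eta V ord0. *)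
Program Definition e_Phi :
    nat_trans G_Phi (functor_comp (forget V) (underlying T V)) :=
  @NatTrans (Coalg T V) SET _ _
    (fun A (f : coalg_hom V_Phi_1 A) => (f 1%N : alg_hom _ _) (eta V (ord0 : 'I_1))) _.
Next Obligation. by []. Qed.

Lemma e_Phi_inj (A : Coalg T V) : injective (e_Phi A : G_Phi A -> _).
Proof.
move=> f g fg; apply: coalg_hom_ext => n.
have f1 : (f : coalg_hom V_Phi_1 A) 1%N = (g : coalg_hom V_Phi_1 A) 1%N.
  by apply: free_hom_ext => i; rewrite (ord1 i).
apply: (coproduct_ext (@V_Phi_1_coproducts n (fun=> 1%N) n (fun i => proj T i) (@proj_power T n))) => i.
rewrite [LHS](@co_naturality T V V_Phi_1 A f 1%N n (proj T i)).
by rewrite [RHS](@co_naturality T V V_Phi_1 A g 1%N n (proj T i)) f1.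
Qed.
End VG.

Section Internal.
Variable V : variety.
Hypothesis hV : commutative_theory (theory_of V).

Lemma tupling_eta k n (f : 'I_n -> hom (theory_of V) k 1) i :
  (tupling f : alg_hom (free V 'I_n) (free V 'I_k)) (eta V i) =
  (f i : alg_hom (free V 'I_1) (free V 'I_k)) (eta V ord0).
Proof.
have := congr1 (fun h : alg_hom (free V 'I_1) (free V 'I_k) => h (eta V ord0)) (tuplingE f i).
move=> <-.
by rewrite -[RHS]/((tupling f : alg_hom _ _) (gen_proj V i (eta V ord0))) free_extE.
Qed.

Lemma oper_comm (B : algebra V) (o p : symbol (sig V))
    (x : 'I_(arity o) -> 'I_(arity p) -> B) :
  oper (fun i => oper (fun j => x i j)) = oper (fun j => oper (fun i => x i j)).
Proof.
pose sg (q : symbol (sig V)) : alg_hom (free V 'I_1) (free V 'I_(arity q)) :=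
  free_ext (fun _ => oper (fun i => eta V i)).
have sgE k (q : symbol (sig V)) (f : 'I_(arity q) -> hom (theory_of V) k 1) :
    (@cmp _ (theory_of V) _ _ _ (sg q) (tupling f) : alg_hom _ _) (eta V ord0) =
    oper (fun i => (f i : alg_hom _ _) (eta V ord0)).
  rewrite -[LHS]/((tupling f : alg_hom _ _) (sg q (eta V ord0))) free_extE hom_oper.
  by congr oper; apply: funext => i; rewrite tupling_eta.
pose X := ('I_(arity o) * 'I_(arity p))%type : finType.
have projE (r : 'I_#|X|) : (proj (theory_of V) r : alg_hom _ _) (eta V (ord0 : 'I_1)) = eta V r.
  exact: free_extE.
pose w := free_ext (fun r : 'I_#|X| => x (enum_val r).1 (enum_val r).2) : alg_hom _ _.
have := congr1 (fun h : alg_hom (free V 'I_1) (free V 'I_#|X|) => w (h (eta V ord0))) (hV (sg o) (sg p)).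
rewrite /= -/(sg o) -/(sg p).
move=> h.
have E1 : w (oper (fun i => oper (fun j => eta V (enum_rank ((i, j) : X))))) =
          w (oper (fun j => oper (fun i => eta V (enum_rank ((i, j) : X))))).
  move: h.
  set a := (X in w X = _ -> _); set b := (X in _ = w X -> _) => h.
  have -> : oper (fun i => oper (fun j => eta V (enum_rank ((i, j) : X)))) = a.
    rewrite /a; symmetry; apply: (eq_trans (sgE _ _ _)); congr oper; apply: funext => i.
    by apply: (eq_trans (sgE _ _ _)); congr oper; apply: funext => j; apply: projE.
  rewrite h; congr (w _).
  rewrite /b; apply: (eq_trans (sgE _ _ _)); congr oper; apply: funext => i.
  by apply: (eq_trans (sgE _ _ _)); congr oper; apply: funext => j; apply: projE.
have wE i j : w (eta V (enum_rank ((i, j) : X))) = x i j.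
  by rewrite free_extE enum_rankK.
move: E1; rewrite !hom_oper.
have L : (fun i => w (oper (fun j => eta V (enum_rank ((i, j) : X))))) = (fun i => oper (fun j => x i j)).
  by apply: funext => i; rewrite hom_oper; congr oper; apply: funext => j.
have M : (fun j => w (oper (fun i => eta V (enum_rank ((i, j) : X))))) = (fun j => oper (fun i => x i j)).
  by apply: funext => j; rewrite hom_oper; congr oper; apply: funext => i.
by rewrite L M.
Qed.

(* The algebra [A, B] of homomorphisms, with pointwise operations. *)
Program Definition ihom_oper (A B : algebra V) (o : symbol (sig V))
    (f : 'I_(arity o) -> alg_hom A B) : alg_hom A B :=
  {| fun_of_hom a := oper (fun i => f i a) |}.
Next Obligation.
move=> A B o f p x /=; rewrite -oper_comm; congr oper.
by apply: funext => i; rewrite hom_oper.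
Qed.

Lemma ihom_eval (A B : algebra V) X (v : X -> alg_hom A B) (t : term (sig V) X) a :
  eval (@ihom_oper A B) v t a = ev (fun x => v x a) t.
Proof. by elim: t => //= o ts IH; congr oper; apply: funext. Qed.

Program Definition ihom (A B : algebra V) : algebra V :=
  {| carrier := alg_hom A B; oper := @ihom_oper A B |}.
Next Obligation.
move=> A B s t st v; apply: alg_hom_ext => a.
by rewrite !ihom_eval; apply: oper_equation.
Qed.

Program Definition ihom_post (A B C : algebra V) (g : alg_hom B C) :
    hom V (ihom A B) (ihom A C) :=
  @AlgHom V (ihom A B) (ihom A C) (fun f => alg_comp g f) _.
Next Obligation. by move=> A B C g o x; apply: alg_hom_ext => a; apply: hom_oper. Qed.

Program Definition ihom_pre (A B C : algebra V) (f : alg_hom A B) :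
    hom V (ihom B C) (ihom A C) :=
  @AlgHom V (ihom B C) (ihom A C) (fun g => alg_comp g f) _.
Next Obligation. by move=> A B C f o x; apply: alg_hom_ext. Qed.

Local Notation cp n A := (@alg_copower V 'I_n A).

(* On objects, N A n is the copower n . A, so ||N A|| = 1 . A is isomorphic to A
   (N_underlying).  For a homomorphism s : F n -> F m, N A s : n . A -> m . A
   restricts on the i-th summand A to the value, in the algebra [A, m . A], of the
   m-ary term operation s (eta i) at the tuple of coprojections.  This is what
   makes R_(N A) C = V(N A -, C) the algebra [A, C]: see N_transpose below, which
   identifies V(N A n, C) with V(F n, [A, C]) naturally in n, A and C. *)
Definition N_map (A : algebra V) (n m : nat) (s : alg_hom (free V 'I_n) (free V 'I_m)) :
    hom V (cp_ob (cp n A)) (cp_ob (cp m A)) :=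
  cp_desc (cp n A) (fun i =>
    (free_ext (A := ihom A (cp_ob (cp m A))) (fun k => cp_in (cp m A) k) : alg_hom _ _)
      (s (eta V i))).

Definition N_transpose (A C : algebra V) (n : nat) (f : hom V (cp_ob (cp n A)) C) :
    hom V (free V 'I_n) (ihom A C) :=
  free_ext (A := ihom A C) (fun i => @cmp _ V _ _ _ f (cp_in (cp n A) i)).

Lemma N_transposeE (A C : algebra V) n (f : hom V (cp_ob (cp n A)) C) i :
  (N_transpose f : alg_hom _ _) (eta V i) = @cmp _ V _ _ _ f (cp_in (cp n A) i).
Proof. exact: free_extE. Qed.

Lemma N_transpose_bij (A C : algebra V) n : bijective (@N_transpose A C n).
Proof.
exists (fun g => cp_desc (cp n A) (fun i => (g : alg_hom _ (ihom A C)) (eta V i))).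
- move=> f; apply: (cp_ext (c := cp n A)) => i.
  by rewrite cp_descE N_transposeE.
- move=> g; apply: free_hom_ext => i.
  by rewrite N_transposeE cp_descE.
Qed.

Lemma N_transpose_post (A C D : algebra V) n (f : hom V (cp_ob (cp n A)) C) (g : hom V C D) :
  N_transpose (@cmp _ V _ _ _ g f) = @cmp _ V _ _ _ (ihom_post A g) (N_transpose f).
Proof.
apply: free_hom_ext => i.
rewrite N_transposeE -[RHS]/(alg_comp g ((N_transpose f : alg_hom _ _) (eta V i))).
by rewrite N_transposeE -cmpA.
Qed.

Lemma N_transpose_natural (A C : algebra V) n m (s : alg_hom (free V 'I_n) (free V 'I_m))
    (f : hom V (cp_ob (cp m A)) C) :
  N_transpose (@cmp _ V _ _ _ f (N_map A s)) = @cmp _ V _ _ _ (N_transpose f) s.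
Proof.
apply: free_hom_ext => i; rewrite N_transposeE -cmpA cp_descE.
rewrite -[RHS]/((N_transpose f : alg_hom _ _) (s (eta V i))).
rewrite -[LHS]/((@cmp _ V _ _ _ (ihom_post A f) (free_ext (A := ihom A (cp_ob (cp m A))) (fun k => cp_in (cp m A) k)) : alg_hom _ _) (s (eta V i))).
by rewrite free_comp.
Qed.

Program Definition N_ob_functor (A : algebra V) : functor (op (theory_of V)) V :=
  @Functor (op (theory_of V)) V (fun n => cp_ob (cp n A)) (fun n m s => N_map A s) _ _.
Next Obligation.
move=> A n; apply: (cp_ext (c := cp n A)) => i.
rewrite cp_descE cmp1m.
exact: (@free_extE V 'I_n (ihom A (cp_ob (cp n A))) (fun k => cp_in (cp n A) k) i).
Qed.
Next Obligation.
move=> A n m k t s; apply: (bij_inj (@N_transpose_bij A _ n)).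
rewrite N_transpose_natural.
rewrite -[N_map A (t \oc s)]cmp1m N_transpose_natural.
rewrite -[N_map A t]cmp1m N_transpose_natural.
exact: (@cmpA _ V).
Qed.

Lemma N_ob_coproducts (A : algebra V) : preserves_finite_coproducts (N_ob_functor A).
Proof.
apply: preserves_powers_coproducts => n.
have E i : @cmp _ V _ _ _ (N_map A (gen_proj V i)) (cp_in (cp 1 A) ord0) = cp_in (cp n A) i.
  by rewrite cp_descE !free_extE.
apply: is_coproductI => Q.
- move=> q; exists (cp_desc (cp n A) (fun i => @cmp _ V _ _ _ (q i) (cp_in (cp 1 A) ord0))).
  move=> i; apply: (cp_ext (c := cp 1 A)) => j; rewrite (ord1 j) -cmpA.
  by rewrite [X in _ \oc X]E cp_descE.
- move=> h h' hh'; apply: (cp_ext (c := cp n A)) => i.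
  by rewrite -E !cmpA [_ \oc N_map _ _]hh'.
Qed.

Definition N_ob (A : algebra V) : coalgebra (theory_of V) V :=
  Coalgebra (@N_ob_coproducts A).

Program Definition N_functor : functor V (Coalg (theory_of V) V) :=
  @Functor V (Coalg (theory_of V) V) N_ob
    (fun A B f => @CoalgHom (theory_of V) V (N_ob A) (N_ob B) (fun n =>
       cp_desc (cp n A) (fun i => @cmp _ V _ _ _ (cp_in (cp n B) i) f)) _) _ _.
Next Obligation.
move=> A B f n m s; apply: (cp_ext (c := cp n A)) => i.
rewrite -[fmap (N_ob A) s]/(N_map A s) -[fmap (N_ob B) s]/(N_map B s).
rewrite -!cmpA !cp_descE cmpA cp_descE.
set d := cp_desc _ _; set t := (s : alg_hom (free V 'I_n) (free V 'I_m)) (eta V i).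
have : @cmp _ V _ _ _ (ihom_post A d) (free_ext (A := ihom A (cp_ob (cp m A))) (fun k => cp_in (cp m A) k))
  = @cmp _ V _ _ _ (ihom_pre (cp_ob (cp m B)) f) (free_ext (A := ihom B (cp_ob (cp m B))) (fun k => cp_in (cp m B) k)).
  rewrite !free_comp; congr (@free_ext V _ (ihom A (cp_ob (cp m B))) _); apply: funext => k.
  exact: (cp_descE (cp m A)).
exact: (congr1 (fun h : alg_hom (free V 'I_m) (ihom A (cp_ob (cp m B))) => h t)).
Qed.
Next Obligation.
move=> A; apply: coalg_hom_ext => n; apply: (cp_ext (c := cp n A)) => i.
by apply: (eq_trans (cp_descE _ _ _)); rewrite cmpm1; apply: (esym (@cmp1m _ V _ _ _)).
Qed.
Next Obligation.
move=> A B C g f; apply: coalg_hom_ext => n; apply: (cp_ext (c := cp n A)) => i.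
apply: (eq_trans (cp_descE _ _ _)).
rewrite -[RHS](@cmpA _ V) cp_descE [RHS](@cmpA _ V).
by rewrite cp_descE (@cmpA _ V).
Qed.

Lemma N_transpose_pre (A B C : algebra V) (f : hom V A B) n (g : hom V (N_ob B n) C) :
  N_transpose (@cmp _ V _ _ _ g ((fmap N_functor f : coalg_hom _ _) n)) =
  @cmp _ V _ _ _ (ihom_pre C f) (N_transpose g).
Proof.
apply: free_hom_ext => i; rewrite N_transposeE -cmpA cp_descE.
rewrite -[RHS]/(alg_comp ((N_transpose g : alg_hom _ _) (eta V i)) f).
by rewrite N_transposeE [LHS](@cmpA _ V).
Qed.

Lemma N_underlying : nat_isomorphic (functor_comp (underlying _ V) N_functor) (functor_id V).
Proof.
unshelve eexists.
  refine (@NatTrans V V (functor_comp (underlying (theory_of V) V) N_functor) (functor_id V)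
    (fun A => cp_desc (cp 1 A) (fun _ => idm (A : V))) _).
  move=> A B f; apply: (cp_ext (c := cp 1 A)) => i.
  by rewrite -!cmpA !cp_descE cmpA cp_descE cmp1m cmpm1.
move=> A; exists (cp_in (cp 1 A) ord0); split; last exact: (cp_descE (cp 1 A)).
apply: (cp_ext (c := cp 1 A)) => i; rewrite -cmpA cp_descE (ord1 i).
by rewrite cmp1m cmpm1.
Qed.
End Internal.

Definition N_Phi (T : lawvere) (V : variety) (hV : commutative_theory (theory_of V))
    (Phi : theory_morphism T (theory_of V)) : functor V (Coalg T V) :=
  functor_comp (coalg_precomp V Phi) (N_functor hV).

(* Main.v *)
Require Import Defs.
From mathcomp Require Import all_boot.
From mathcomp Require Import boolp classical_sets.

Set Implicit Arguments.
Unset Strict Implicit.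
Unset Printing Implicit Defensive.
#[local] Obligation Tactic := idtac.

(** Operations of [V] commute with one another, so for any two coalgebras [B]
and [A] the operations applied componentwise and pointwise to coalgebra
morphisms [B -> A] give coalgebra morphisms again: the components are
homomorphisms by commutativity, and naturality survives because each [A s] is
a homomorphism.  Hence the category of coalgebras is enriched in [V]
([coalg_hom_algebra]).  The lifting of [G_Phi] is the enriched hom functor out
of [V_Phi_1], with carrier [G_Phi A] itself rather than its image under [e];
evaluation at the free generator is then a homomorphism [e_bar], and the image
of [e] is a subalgebra.

The adjunction is a tensor-hom adjunction.  An element [b] of [B] defines the
coalgebra morphism from [V_Phi_1] to [N_Phi B] that sends the [i]-th generator
of [F n] to the copy of [b] in the [i]-th summand of [n . B]
([element_coalg_hom]); this is the unit.  The counit is, on the [i]-th summand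
of [n . G A], evaluation of morphisms at the [i]-th generator of [F n].
Its naturality is the one delicate point: the action of [N_Phi] on a term is
computed by that term in the algebra of homomorphisms [G A -> A m], where the
evaluations at the generators of [F m] are combined into the evaluation at the
value of the term ([coalg_hom_curry]).

As [e] is injective, [e_bar] is monic, so a homomorphism into the lifting of
[G_Phi] is an isomorphism as soon as its composite with [e_bar] is one.  For
the unit this composite is the coprojection of [B] into [1 . B]; for the
homomorphism [F X -> G (V_Phi X)] given by the coprojections it is the
isomorphism of [F X] with [X . F 1].  An adjunction whose unit is invertible
exhibits its left adjoint as the inclusion, up to equivalence, of the full
coreflective subcategory of the objects with invertible counit
([coreflective_of_unit_iso]). *)

(** * Categorical preliminaries *)

Section Isomorphisms.
Variable C : category.

Lemma is_iso_id (a : C) : is_iso (idm a).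
Proof. by exists (idm a); rewrite cmp1m. Qed.

Lemma is_iso_inverse (a b : C) (f : hom C a b) (g : hom C b a) :
  g \oc f = idm a -> f \oc g = idm b -> is_iso g.
Proof. by move=> gf fg; exists f. Qed.

(** The inverse of [h] is that of [m \oc h] precomposed with [m]; monicity is
    what makes it two-sided. *)
Lemma is_iso_of_monic_comp (a b c : C) (m : hom C b c) (h : hom C a b) :
  (forall x (u v : hom C x b), m \oc u = m \oc v -> u = v) ->
  is_iso (m \oc h) -> is_iso h.
Proof.
move=> mono_m [g [gmh mhg]]; exists (g \oc m); split; first by rewrite -cmpA.
by apply: mono_m; rewrite !cmpA mhg cmp1m cmpm1.
Qed.

End Isomorphisms.

Section NaturalIsomorphisms.
Variables C D : category.

Lemma fmap_iso (F : functor C D) (a b : C) (f : hom C a b) :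
  is_iso f -> is_iso (fmap F f).
Proof. by case=> g [gf fg]; exists (fmap F g); rewrite -!fmapM gf fg !fmap1. Qed.

Lemma nat_trans_inverse (F G : functor C D) (s : nat_trans F G) :
  (forall a, is_iso (s a)) ->
  exists t : nat_trans G F,
    forall a, t a \oc s a = idm (F a) /\ s a \oc t a = idm (G a).
Proof.
move=> s_iso; pose t a := sval (cid (s_iso a)).
have tE a := svalP (cid (s_iso a)).
suff tN a b (f : hom C a b) : t b \oc fmap G f = fmap F f \oc t a.
  by exists (NatTrans (component := t) tN).
rewrite -[LHS]cmpm1 -(tE a).2 cmpA -(cmpA (t b)) -naturality.
by rewrite cmpA (tE b).1 cmp1m.
Qed.

Lemma nat_isomorphic_sym (F G : functor C D) :
  nat_isomorphic F G -> nat_isomorphic G F.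
Proof.
case=> s /nat_trans_inverse [t tE]; exists t => a.
by have [ts st] := tE a; apply: is_iso_inverse ts st.
Qed.
End NaturalIsomorphisms.

Section Coreflection.
Variables (C D : category) (L : functor C D) (R : functor D C).
Variable unit : nat_trans (functor_id C) (functor_comp R L).
Variable counit : nat_trans (functor_comp L R) (functor_id D).
Hypothesis triangleL : forall a, counit (L a) \oc fmap L (unit a) = idm (L a).
Hypothesis triangleR : forall b, fmap R (counit b) \oc unit (R b) = idm (R b).
Hypothesis unit_iso : forall a, is_iso (unit a).

(** Objects with invertible counit, rather than objects isomorphic to some
    [L c]: the two agree as the unit is invertible, and here the isomorphism
    is canonical. *)
Definition counit_fixed (d : D) : Prop := is_iso (counit d).

(** By a triangle identity the counit at [L c] is a one-sided inverse of the
    isomorphism [L (unit c)], hence its inverse. *)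
Lemma counit_fixed_image (c : C) : counit_fixed (L c).
Proof.
have [g [gf fg]] := fmap_iso L (unit_iso c).
apply: (is_iso_inverse (f := fmap L (unit c))) (triangleL c) _.
by rewrite -[RHS]fg -[counit _]cmpm1 -fg (cmpA (counit _)) triangleL cmp1m.
Qed.

Definition corestriction : functor C (full_sub counit_fixed) :=
  @Functor C (full_sub counit_fixed)
    (fun c => exist counit_fixed (L c) (counit_fixed_image c))
    (fun a b f => fmap L f) (fun a => fmap1 L a)
    (fun a b c g f => fmapM L g f).

(** The coreflector is [L R]: its counit is that of the adjunction, and its unit
    is the inverse of the counit on the fixed objects. *)
Lemma counit_fixed_coreflective : coreflective counit_fixed.
Proof.
exists (functor_comp corestriction R).
pose counitP : nat_trans (functor_comp (functor_comp L R) (full_incl counit_fixed))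
    (full_incl counit_fixed) :=
  @NatTrans (full_sub counit_fixed) D
    (functor_comp (functor_comp L R) (full_incl counit_fixed)) (full_incl counit_fixed)
    (fun a => counit (sval a)) (fun a b f => naturality counit f).
have [t tE] := nat_trans_inverse (s := counitP) (fun a => svalP a).
exists (@NatTrans (full_sub counit_fixed) (full_sub counit_fixed) (functor_id _)
  (functor_comp (functor_comp corestriction R) (full_incl counit_fixed))
  t (fun a b f => naturality t f)).
exists (@NatTrans D D
  (functor_comp (full_incl counit_fixed) (functor_comp corestriction R))
  (functor_id D) counit (fun a b f => naturality counit f)).
split=> [a|b] /=; first exact: (tE a).2.
(* Both are left inverses of the isomorphism L (unit (R b)). *)
have -> : fmap L (fmap R (counit b)) = counit (L (R b)).
  have [g [_ fg]] := fmap_iso L (unit_iso (R b)).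
  rewrite -[LHS]cmpm1 -[RHS]cmpm1 -fg !cmpA triangleL.
  by rewrite -fmapM triangleR fmap1.
exact: (tE (corestriction (R b))).2.
Qed.

Lemma corestriction_equivalence : is_equivalence corestriction.
Proof.
exists (functor_comp R (full_incl counit_fixed)); split.
  apply: nat_isomorphic_sym.
  exists (@NatTrans C C (functor_id C)
    (functor_comp (functor_comp R (full_incl counit_fixed)) corestriction)
    unit (fun a b f => naturality unit f)).
  exact: unit_iso.
exists (@NatTrans (full_sub counit_fixed) (full_sub counit_fixed)
  (functor_comp corestriction (functor_comp R (full_incl counit_fixed)))
  (functor_id _) (fun a => counit (sval a)) (fun a b f => naturality counit f)).
by move=> a; apply: svalP a.
Qed.

Lemma full_incl_corestriction :
  nat_isomorphic (functor_comp (full_incl counit_fixed) corestriction) L.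
Proof.
exists (@NatTrans C D (functor_comp (full_incl counit_fixed) corestriction) L
  (fun a => idm (L a))
  (fun a b f => etrans (cmp1m (fmap L f)) (esym (cmpm1 (fmap L f))))).
by move=> a; apply: is_iso_id.
Qed.

Lemma coreflective_of_unit_iso :
  exists (P : D -> Prop) (E : functor C (full_sub P)),
    coreflective P /\ is_equivalence E /\
    nat_isomorphic (functor_comp (full_incl P) E) L.
Proof.
exists counit_fixed, corestriction; split; first exact: counit_fixed_coreflective.
by split; [exact: corestriction_equivalence|exact: full_incl_corestriction].
Qed.
End Coreflection.

(** * Algebras of coalgebra morphisms *)

Section CoalgHomAlgebra.
Variables (T : lawvere) (V : variety).
Hypothesis hV : commutative_theory (theory_of V).

(** Commutativity makes each component of the pointwise operation a
    homomorphism; it is natural because each [A s] commutes with operations. *)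
Program Definition coalg_hom_oper (B A : coalgebra T V) (o : symbol (sig V))
    (f : 'I_(arity o) -> coalg_hom B A) : coalg_hom B A :=
  @CoalgHom T V B A (fun n => ihom_oper hV (fun i => f i n)) _.
Next Obligation.
move=> B A o f n m s; apply: alg_hom_ext => b.
rewrite [RHS](hom_oper (fmap A s)) /=; congr oper; apply: funext => i.
exact: (congr1 (fun h : alg_hom _ _ => h b) (co_naturality (f i) s)).
Qed.

Lemma coalg_hom_eval (B A : coalgebra T V) X (v : X -> coalg_hom B A)
    (t : term (sig V) X) n b :
  (eval (@coalg_hom_oper B A) v t n : alg_hom _ _) b =
  eval (@oper V (A n)) (fun x => (v x n : alg_hom _ _) b) t.
Proof. by elim: t => //= o ts IH; congr oper; apply: funext. Qed.

Program Definition coalg_hom_algebra (B A : coalgebra T V) : algebra V :=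
  {| carrier := coalg_hom B A; oper := @coalg_hom_oper B A |}.
Next Obligation.
move=> B A s t st v; apply: coalg_hom_ext => n; apply: alg_hom_ext => b.
by rewrite !coalg_hom_eval; apply: oper_equation.
Qed.

Program Definition coalg_hom_post (B A A' : coalgebra T V) (g : coalg_hom A A') :
    hom V (coalg_hom_algebra B A) (coalg_hom_algebra B A') :=
  @AlgHom V (coalg_hom_algebra B A) (coalg_hom_algebra B A')
    (fun f => coalg_comp g f) _.
Next Obligation.
move=> B A A' g o f; apply: coalg_hom_ext => n; apply: alg_hom_ext => b.
exact: (hom_oper (g n)).
Qed.

Program Definition coalg_hom_at (B A : coalgebra T V) n (b : (B n : algebra V)) :
    hom V (coalg_hom_algebra B A) (A n) :=
  @AlgHom V (coalg_hom_algebra B A) (A n) (fun f => (f n : alg_hom _ _) b) _.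
Next Obligation. by []. Qed.

(** Each coalgebra morphism is a homomorphism in its argument [b] as well, so
    [b] can be replaced by a term in other elements: the evaluation at that
    term is then the same term in the evaluations at these elements. *)
Program Definition coalg_hom_curry (B A : coalgebra T V) n :
    hom V (B n) (ihom hV (coalg_hom_algebra B A) (A n)) :=
  @AlgHom V (B n) (ihom hV (coalg_hom_algebra B A) (A n))
    (fun b => coalg_hom_at A b) _.
Next Obligation.
by move=> B A n o b; apply: alg_hom_ext => f; apply: (hom_oper (f n)).
Qed.
End CoalgHomAlgebra.

(** * The adjunction *)

Section Adjunction.
Variables (T : lawvere) (V : variety).
Hypothesis hV : commutative_theory (theory_of V).
Variable Phi : theory_morphism T (theory_of V).

Local Notation V1 := (V_Phi_1 Phi).
Local Notation N := (N_Phi hV Phi).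
Local Notation cp n A := (@alg_copower V 'I_n A).

(** The carrier is the set of morphisms and not its image under [e]; so
    [G_bar] lifts [G_Phi] on the nose, and [e] becomes a homomorphism instead
    of an inclusion. *)
Program Definition G_bar : functor (Coalg T V) V :=
  @Functor (Coalg T V) V (fun A => coalg_hom_algebra hV V1 A)
    (fun A B g => coalg_hom_post hV V1 g) _ _.
Next Obligation.
by move=> A; apply: alg_hom_ext => f; apply: (@cmp1m _ (Coalg T V)).
Qed.
Next Obligation.
move=> A B C g h; apply: alg_hom_ext => f.
exact: (esym (@cmpA _ (Coalg T V) _ _ _ _ g h f)).
Qed.

Program Definition G_bar_forget :
    nat_trans (functor_comp (forget V) G_bar) (G_Phi Phi) :=
  @NatTrans (Coalg T V) SET (functor_comp (forget V) G_bar) (G_Phi Phi)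
    (fun A f => f) _.
Next Obligation. by []. Qed.

Program Definition e_bar : nat_trans G_bar (underlying T V) :=
  @NatTrans (Coalg T V) V G_bar (underlying T V)
    (fun A => coalg_hom_at hV A (B := V1) (n := 1) (eta V ord0)) _.
Next Obligation. by move=> A B g; apply: alg_hom_ext. Qed.

Lemma e_bar_monic (A : Coalg T V) (B : V) (u v : hom V B (G_bar A)) :
  e_bar A \oc u = e_bar A \oc v -> u = v.
Proof.
move=> uv; apply: alg_hom_ext => b; apply: (@e_Phi_inj T V Phi A).
exact: (congr1 (fun h : alg_hom B (underlying T V A) => h b) uv).
Qed.

(** Naturality holds because the value of [N_map] on the [i]-th summand is the
    term [Phi s (eta i)] in the coprojections [B -> m . B], computed
    pointwise; at [b] it is this term in the copies of [b]. *)
Program Definition element_coalg_hom (B : algebra V) (b : B) : coalg_hom V1 (N B) :=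
  @CoalgHom T V V1 (N B)
    (fun n => free_ext (fun i => (cp_in (cp n B) i : alg_hom _ _) b)) _.
Next Obligation.
move=> B b n m s.
(* Operations on homomorphisms being pointwise, evaluation at b is itself a
   homomorphism, and so can be moved inside a term. *)
pose at_b : hom V (ihom hV B (cp_ob (cp m B))) (cp_ob (cp m B)) :=
  @AlgHom V (ihom hV B (cp_ob (cp m B))) (cp_ob (cp m B))
    (fun f => (f : alg_hom _ _) b) (fun _ _ => erefl).
apply: free_hom_ext => i.
rewrite -[RHS]/((N_map hV B (tm_map Phi s) : alg_hom _ _)
  ((free_ext _ : alg_hom _ _) (eta V i))) free_extE.
have := cp_descE (cp n B) (fun i => (free_ext (A := ihom hV B (cp_ob (cp m B)))
    (fun k => cp_in (cp m B) k) : alg_hom _ _)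
    ((tm_map Phi s : alg_hom (free V 'I_n) (free V 'I_m)) (eta V i))) i.
move/(congr1 (fun h : alg_hom B (cp_ob (cp m B)) => h b)) => /= ->.
rewrite -[RHS]/((@cmp _ V _ _ _ at_b (free_ext _) : alg_hom _ _) _).
by rewrite free_comp.
Qed.

Lemma e_bar_element (B : algebra V) (b : B) :
  (e_bar (N B) : alg_hom _ _) (element_coalg_hom b) =
  (cp_in (cp 1 B) ord0 : alg_hom _ _) b.
Proof. exact: free_extE. Qed.

(** Since [e] is injective, it suffices to compare generators, where [b] is
    sent to its copy in [1 . B]: that is a homomorphism in [b]. *)
Program Definition N_unit_component (B : algebra V) : hom V B (G_bar (N B)) :=
  @AlgHom V B (G_bar (N B)) (@element_coalg_hom B) _.
Next Obligation.
move=> B o x; apply: (@e_Phi_inj T V Phi (N B)).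
rewrite -[LHS]/((e_bar (N B) : alg_hom _ _) (element_coalg_hom (oper x))).
rewrite -[RHS]/((e_bar (N B) : alg_hom _ _)
  (oper (fun i => element_coalg_hom (x i) : G_bar (N B) : algebra V))).
rewrite e_bar_element !hom_oper; congr oper; apply: funext => i.
by rewrite e_bar_element.
Qed.

Lemma e_bar_unit (B : algebra V) :
  e_bar (N B) \oc N_unit_component B = cp_in (cp 1 B) ord0.
Proof. by apply: alg_hom_ext => b; apply: e_bar_element. Qed.

Program Definition N_unit : nat_trans (functor_id V) (functor_comp G_bar N) :=
  @NatTrans V V (functor_id V) (functor_comp G_bar N) N_unit_component _.
Next Obligation.
move=> A B f; apply: e_bar_monic.
rewrite cmpA e_bar_unit cmpA (naturality e_bar) -cmpA e_bar_unit.
exact: (esym (cp_descE (cp 1 A) _ ord0)).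
Qed.

Lemma copower1_in_iso (B : algebra V) : @is_iso V _ _ (cp_in (cp 1 B) ord0).
Proof.
exists (cp_desc (cp 1 B) (fun=> idm (B : V))); split; first exact: cp_descE.
apply: cp_ext => i; rewrite (ord1 i) -cmpA cp_descE.
by rewrite cmp1m cmpm1.
Qed.

(** After [e_bar] the unit becomes the isomorphism of [B] with [1 . B]. *)
Lemma N_unit_iso (B : V) : is_iso (N_unit B).
Proof.
apply: (is_iso_of_monic_comp (C := V) (m := e_bar (N B))) => [X u v|].
  exact: e_bar_monic.
by rewrite e_bar_unit; apply: copower1_in_iso.
Qed.

Definition at_generator (A : coalgebra T V) n (i : 'I_n) : hom V (G_bar A) (A n) :=
  coalg_hom_at hV A (B := V1) (n := n) (eta V i).

Program Definition N_counit_component (A : coalgebra T V) : coalg_hom (N (G_bar A)) A :=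
  @CoalgHom T V (N (G_bar A)) A (fun n =>
    cp_desc (cp n (G_bar A)) (@at_generator A n)) _.
Next Obligation.
move=> A n m s; apply: (cp_ext (c := cp n (G_bar A))) => i.
rewrite -!cmpA [in RHS]cp_descE.
rewrite [X in _ \oc X](cp_descE (cp n (G_bar A))).
set w := (tm_map Phi s : alg_hom (free V 'I_n) (free V 'I_m)) (eta V i).
(* Both sides are homomorphisms on F m that agree on the generators; taken at
   w, the equation reduces naturality to that of the morphisms f in G_bar A. *)
have : @cmp _ V _ _ _
    (ihom_post hV (G_bar A) (cp_desc (cp m (G_bar A)) (@at_generator A m)))
    (free_ext (A := ihom hV (G_bar A) (cp_ob (cp m (G_bar A))))
      (fun k => cp_in (cp m (G_bar A)) k))
  = coalg_hom_curry hV V1 A m.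
  rewrite free_comp; apply: free_hom_ext => k; rewrite free_extE.
  exact: (cp_descE (cp m (G_bar A)) (@at_generator A m) k).
move/(congr1 (fun h : alg_hom (free V 'I_m) (ihom hV (G_bar A) (A m)) => h w)) => E.
apply: (eq_trans E); apply: alg_hom_ext => f.
exact: (congr1 (fun h : alg_hom _ _ => h (eta V i)) (co_naturality (f : coalg_hom V1 A) s)).
Qed.

Program Definition N_counit : nat_trans (functor_comp N G_bar) (functor_id (Coalg T V)) :=
  @NatTrans (Coalg T V) (Coalg T V) (functor_comp N G_bar) (functor_id (Coalg T V))
    N_counit_component _.
Next Obligation.
move=> A B g; apply: coalg_hom_ext => n; apply: (cp_ext (c := cp n (G_bar A))) => i.
apply: (@eq_trans _ _ (@cmp _ V _ _ _ (g n) (at_generator A i))).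
  apply: (eq_trans (esym (@cmpA _ V _ _ _ _ _ _ _))).
  rewrite [X in _ \oc X](cp_descE (cp n (G_bar A))) cmpA.
  rewrite [X in X \oc _](cp_descE (cp n (G_bar B))).
  exact: alg_hom_ext.
rewrite -[RHS](@cmpA _ V); congr (_ \oc _); symmetry.
exact: (cp_descE (cp n (G_bar A))).
Qed.

Lemma N_counit_unit (B : V) : N_counit (N B) \oc fmap N (N_unit B) = idm (N B).
Proof.
apply: coalg_hom_ext => n; apply: (cp_ext (c := cp n B)) => i.
apply: (eq_trans (esym (@cmpA _ V _ _ _ _ _ _ _))).
rewrite [X in _ \oc X](cp_descE (cp n B)) cmpA.
rewrite [X in X \oc _](cp_descE (cp n (G_bar (N B)))).
apply: (eq_trans _ (esym (@cmp1m _ V _ _ _))).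
by apply: alg_hom_ext => b; apply: free_extE.
Qed.

Lemma N_unit_counit (A : Coalg T V) :
  fmap G_bar (N_counit A) \oc N_unit (G_bar A) = idm (G_bar A).
Proof.
apply: e_bar_monic; rewrite cmpA (naturality e_bar) -cmpA e_bar_unit cmpm1.
exact: (cp_descE (cp 1 (G_bar A))).
Qed.

Lemma N_Phi_left_adjoint : left_adjoint N G_bar.
Proof. by exists N_unit, N_counit; split; [exact: N_counit_unit|exact: N_unit_counit]. Qed.

Lemma G_bar_N_Phi : nat_isomorphic (functor_comp G_bar N) (functor_id V).
Proof. by apply: nat_isomorphic_sym; exists N_unit; apply: N_unit_iso. Qed.

(** * Free algebras and copowers *)

Definition coprojections (X : Type) : hom V (free V X) (G_bar (V_Phi Phi X)) :=
  free_ext (A := coalg_hom_algebra hV V1 (V_Phi Phi X))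
    (fun x => cp_in (coalg_copower X V1) x).

Lemma coprojections_gen (X : Type) (x : X) :
  (coprojections X : alg_hom _ _) (eta V x) = cp_in (coalg_copower X V1) x.
Proof. exact: free_extE. Qed.

(** Composed with [e_bar] this is the comparison of [F X] with [X . F 1], whose
    inverse sends the generator of the [x]-th summand to [eta x]. *)
Lemma coprojections_iso (X : Type) : is_iso (coprojections X).
Proof.
apply: (is_iso_of_monic_comp (C := V) (m := e_bar (V_Phi Phi X))) => [Y u v|].
  exact: e_bar_monic.
pose c := @alg_copower V X (free V 'I_1).
pose p x : hom V (free V 'I_1) (free V X) := free_ext (fun=> eta V x).
have eE x : (e_bar (V_Phi Phi X) \oc coprojections X : alg_hom _ _) (eta V x) =
    (cp_in c x : alg_hom _ _) (eta V ord0).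
  rewrite -[LHS]/((e_bar (V_Phi Phi X) : alg_hom _ _)
    ((coprojections X : alg_hom _ _) (eta V x))).
  by rewrite coprojections_gen.
have dE x y : (cp_desc c p : alg_hom _ _) ((cp_in c x : alg_hom _ _) y) = (p x : alg_hom _ _) y.
  exact: (congr1 (fun h : alg_hom _ _ => h y) (cp_descE c p x)).
exists (cp_desc c p); split.
  apply: free_hom_ext => x.
  by apply: (eq_trans (congr1 (cp_desc c p : alg_hom _ _) (eE x))); rewrite dE free_extE.
apply: (cp_ext (c := c)) => x; apply: free_hom_ext => i; rewrite (ord1 i).
apply: (eq_trans (congr1 (e_bar (V_Phi Phi X) \oc coprojections X : alg_hom _ _) (dE x _))).
by rewrite free_extE; apply: eE.
Qed.

Lemma G_bar_V_Phi :
  nat_isomorphic (functor_comp G_bar (V_Phi Phi)) (free_functor V).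
Proof.
apply: nat_isomorphic_sym; unshelve eexists.
  refine (@NatTrans SET V (free_functor V) (functor_comp G_bar (V_Phi Phi))
    coprojections _) => X Y f.
  apply: free_hom_ext => x.
  apply: (@eq_trans _ _ (cp_in (coalg_copower Y V1) (f x))).
    apply: (eq_trans (congr1 (coprojections Y : alg_hom _ _) (free_extE _ x))).
    exact: coprojections_gen.
  symmetry.
  apply: (eq_trans (congr1 (fmap G_bar (fmap (V_Phi Phi) f) : alg_hom _ _) (coprojections_gen x))).
  exact: (cp_descE (coalg_copower X V1)).
exact: coprojections_iso.
Qed.
End Adjunction.

(** * The lifting of [G_Phi] as a coreflector *)

Theorem theorem29 (T : lawvere) (V : variety)
    (hV : commutative_theory (theory_of V))
    (Phi : theory_morphism T (theory_of V)) :
  (forall A : Coalg T V,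
     @subalgebra V (underlying T V A) (range (e_Phi Phi A))) /\
  exists (Gbar : functor (Coalg T V) V)
         (alpha : nat_trans (functor_comp (forget V) Gbar) (G_Phi Phi))
         (ebar : nat_trans Gbar (underlying T V)),
    (forall A : Coalg T V, is_iso (alpha A)) /\
    (forall A : Coalg T V,
       fmap (forget V) (ebar A) = e_Phi Phi A \oc alpha A) /\
    nat_isomorphic (functor_comp Gbar (N_Phi hV Phi)) (functor_id V) /\
    nat_isomorphic (functor_comp Gbar (V_Phi Phi)) (free_functor V) /\
    left_adjoint (N_Phi hV Phi) Gbar /\
    exists (P : Coalg T V -> Prop) (E : functor V (full_sub P)),
      coreflective P /\ is_equivalence E /\
      nat_isomorphic (functor_comp (full_incl P) E) (N_Phi hV Phi).
Proof.
split=> [A o x xG|].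
  have [f fx] : exists f : 'I_(arity o) -> coalg_hom (V_Phi_1 Phi) A,
      forall i, e_Phi Phi A (f i) = x i.
    exists (fun i => sval (cid2 (xG i))) => i.
    by case: (cid2 (xG i)).
  have -> : x = fun i => (e_bar hV Phi A : alg_hom _ _) (f i).
    by apply: funext => i; rewrite -fx.
  by exists (coalg_hom_oper hV f).
exists (G_bar hV Phi), (G_bar_forget hV Phi), (e_bar hV Phi).
split; first by move=> A; apply: (@is_iso_id SET).
split; first by [].
split; first exact: G_bar_N_Phi.
split; first exact: G_bar_V_Phi.
split; first exact: N_Phi_left_adjoint.
exact: (coreflective_of_unit_iso (@N_counit_unit T V hV Phi) (@N_unit_counit T V hV Phi)
  (@N_unit_iso T V hV Phi)).
Qed.
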